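(* The class $MD( *,1)$ coincides with the class of all (finite-dimensional) real solvable Lie algebras whose first derived ideal is $1$-dimensional; moreover, it consists only of the Lie algebra $\mathrm{aff}(\mathbb{R})$, the real Heisenberg Lie algebras, and their direct sums with real commutative Lie algebras. In other words: let $n \geqslant 2$ be an integer and let $\mathcal{G}$ be an $n$-dimensional real solvable Lie algebra whose first derived ideal $\mathcal{G}^1 = [\mathcal{G},\mathcal{G}]$ is $1$-dimensional. Then $\mathcal{G}$ is an $MD(n,1)$-algebra, and $\mathcal{G}$ is isomorphic to one and only one of the following Lie algebras: (i) $\mathrm{aff}(\mathbb{R})$, with $n = 2$; (ii) $\mathrm{aff}(\mathbb{R}) \oplus \mathbb{R}^{n-2}$, with $3 \leqslant n$; (iii) the real Heisenberg Lie algebra $\mathfrak{h}_{2m+1}$, with $3 \leqslant n = 2m+1$; (iv) $\mathfrak{h}_{2m+1} \oplus \mathbb{R}^{n-2m-1}$, with $3 \leqslant 2m+1 < n$.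
   Context: For a Lie group $G$ with Lie algebra $\mathcal{G}$, the coadjoint representation $K$ of $G$ in the dual space $\mathcal{G}^*$ is $\langle K_{(g)}F, X\rangle = \langle F, \mathrm{Ad}(g^{-1})X\rangle$, and its orbits are called $K$-orbits. The $K$-orbit $\Omega_F$ of $F\in\mathcal{G}^*$ has dimension equal to the rank of the skew-symmetric bilinear form $B_F(X,Y)=\langle F,[X,Y]\rangle$ on $\mathcal{G}$. An $MD$-group is a finite-dimensional real solvable Lie group (taken connected and simply connected) each of whose $K$-orbits has dimension either zero or the maximal dimension among all $K$-orbits of the group. An $MD$-algebra is the Lie algebra of an $MD$-group (equivalently, a finite-dimensional real solvable Lie algebra for which every $B_F$ has rank $0$ or rank $\max_{F'}\operatorname{rank}B_{F'}$). For $0<m<n$, an $MD(n,m)$-algebra is an $n$-dimensional $MD$-algebra whose first derived ideal $\mathcal{G}^1=[\mathcal{G},\mathcal{G}]$ is $m$-dimensional. $MD( *,1)$ is the class of all $MD$-algebras, of arbitrary dimension, whose first derived ideal is $1$-dimensional. $\mathrm{aff}(\mathbb{R})$ is the $2$-dimensional real Lie algebra with basis $(X,Y)$ and $[X,Y]=Y$ (the Lie algebra of the group of affine transformations of the real line). For an integer $m>0$, $\mathfrak{h}_{2m+1}$ is the $(2m+1)$-dimensional real Lie algebra with basis $(X_1,Y_1,\dots,X_m,Y_m,Z)$ and brackets $[X_i,Y_i]=Z$ for $i=1,\dots,m$, all other brackets of basis vectors being trivial. $\mathbb{R}^k$ denotes the $k$-dimensional commutative real Lie algebra and $\oplus$ the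 direct sum of Lie algebras. *)

(* Defs.v *)
From HB Require Import structures.
From mathcomp Require Import all_boot all_order all_algebra.
From mathcomp Require Import reals.
From mathcomp Require Import ring.

Set Implicit Arguments.
Unset Strict Implicit.
Unset Printing Implicit Defensive.

Import Order.TTheory GRing.Theory Num.Theory.
Local Open Scope ring_scope.

HB.mixin Record isLieAlgebra (F : fieldType) L of Vector F L := {
  lie : L -> L -> L;
  lie_linear_l : forall y, linear (fun x => lie x y);
  lie_linear_r : forall x, linear (lie x);
  lie_alt : forall x, lie x x = 0;
  lie_jacobi : forall x y z,
    lie x (lie y z) + lie y (lie z x) + lie z (lie x y) = 0
}.

#[short(type="lieAlgType")]
HB.structure Definition LieAlgebra (F : fieldType) :=
  { L of isLieAlgebra F L & Vector F L }.

Section DerivedSeries.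
Variables (F : fieldType) (L : lieAlgType F).
Implicit Types U W : {vspace L}.

(* By bilinearity, the brackets of basis vectors suffice to span [U, W]; see
   [mem_lie_prod] and [lie_prod_subP]. *)
Definition lie_prod U W : {vspace L} :=
  <<[seq lie u w | u <- vbasis U, w <- vbasis W]>>%VS.

Definition derived_series (k : nat) : {vspace L} :=
  iter k (fun U => lie_prod U U) fullv.

Definition derived_ideal : {vspace L} := lie_prod fullv fullv.

Definition lie_solvable : Prop := exists k, derived_series k = 0%VS.

Lemma mem_lie_prod U W x y : x \in U -> y \in W -> lie x y \in lie_prod U W.
Proof.
move=> xU yW; pose fl z := HB.pack_for {linear L -> L} (fun t : L => lie t z)
  (GRing.isLinear.Build F L L *:%R _ (lie_linear_l z)).
pose fr z := HB.pack_for {linear L -> L} (fun t : L => lie z t)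
  (GRing.isLinear.Build F L L *:%R _ (lie_linear_r z)).
rewrite (coord_vbasis xU) -[lie _ _]/(fl y _) linear_sum memv_suml // => i _.
rewrite linearZ memvZ //= (coord_vbasis yW) -[lie _ _]/(fr _ _) linear_sum.
rewrite memv_suml // => j _; rewrite linearZ memvZ //=.
by apply/memv_span/allpairs_f; apply: mem_nth; rewrite size_tuple.
Qed.

Lemma lie_prod_subP U W (V : {vspace L}) :
  (forall x y, x \in U -> y \in W -> lie x y \in V) -> (lie_prod U W <= V)%VS.
Proof.
move=> sV; apply/span_subvP => _ /allpairsP[[x y] /= [xU yW ->]].
by apply: sV; apply: vbasis_mem.
Qed.

End DerivedSeries.

Section CoadjointForm.
Variables (F : fieldType) (L : lieAlgType F).

Definition coadj_form (f : 'Hom(L, F^o)) (x y : L) : F := f (lie x y).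

(* The rank of the skew-symmetric form B_f, as the rank of its Gram matrix;
   over the reals this is the dimension of the K-orbit of f. *)
Definition Korbit_dim (f : 'Hom(L, F^o)) : nat :=
  \rank (\matrix_(i < \dim {:L}, j < \dim {:L})
           coadj_form f (vbasis {:L})`_i (vbasis {:L})`_j).

Definition MD_algebra : Prop :=
  lie_solvable L /\
  forall f, Korbit_dim f = 0%N \/ forall f', (Korbit_dim f' <= Korbit_dim f)%N.

Definition MD_nm (n m : nat) : Prop :=
  [/\ (0 < m < n)%N, MD_algebra, \dim {:L} = n & \dim (derived_ideal L) = m].

Definition MD_star1 : Prop := MD_algebra /\ \dim (derived_ideal L) = 1%N.

End CoadjointForm.

Definition lie_iso (F : fieldType) (L M : lieAlgType F) : Prop :=
  exists2 f : {linear L -> M},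
    bijective f & forall x y, f (lie x y) = lie (f x) (f y).

Section DirectSum.
Variables (F : fieldType) (L M : lieAlgType F).

Definition lie_pair (x y : L * M) : L * M := (lie x.1 y.1, lie x.2 y.2).

Fact lie_pair_linear_l y : linear (fun x => lie_pair x y).
Proof. by move=> a u v; congr pair; apply: lie_linear_l. Qed.

Fact lie_pair_linear_r x : linear (lie_pair x).
Proof. by move=> a u v; congr pair; apply: lie_linear_r. Qed.

Fact lie_pair_alt x : lie_pair x x = 0.
Proof. by rewrite /lie_pair !lie_alt. Qed.

Fact lie_pair_jacobi x y z :
  lie_pair x (lie_pair y z) + lie_pair y (lie_pair z x)
    + lie_pair z (lie_pair x y) = 0.
Proof. by congr pair; apply: lie_jacobi. Qed.

HB.instance Definition _ := isLieAlgebra.Build F (L * M)%type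
  lie_pair_linear_l lie_pair_linear_r lie_pair_alt lie_pair_jacobi.

End DirectSum.

Definition abelianLie (F : fieldType) (k : nat) : Type := 'rV[F]_k.

Section Abelian.
Variables (F : fieldType) (k : nat).
Local Notation A := (abelianLie F k).

HB.instance Definition _ := Vector.on A.

Definition lie_abelian (x y : A) : A := 0.

Fact lie_abelian_linear_l y : linear (fun x => lie_abelian x y).
Proof. by move=> a u v; rewrite scaler0 addr0. Qed.

Fact lie_abelian_linear_r x : linear (lie_abelian x).
Proof. by move=> a u v; rewrite scaler0 addr0. Qed.

Fact lie_abelian_alt x : lie_abelian x x = 0. Proof. by []. Qed.

Fact lie_abelian_jacobi x y z :
  lie_abelian x (lie_abelian y z) + lie_abelian y (lie_abelian z x)
    + lie_abelian z (lie_abelian x y) = 0.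
Proof. by rewrite !addr0. Qed.

HB.instance Definition _ := isLieAlgebra.Build F A
  lie_abelian_linear_l lie_abelian_linear_r lie_abelian_alt lie_abelian_jacobi.

End Abelian.

(* The pair (a, b) stands for a X + b Y, where [X, Y] = Y. *)
Definition affLie (F : fieldType) : Type := (F^o * F^o)%type.

Section Aff.
Variable F : fieldType.
Local Notation A := (affLie F).

HB.instance Definition _ := Vector.on A.

Definition lie_aff (x y : A) : A := (0, x.1 * y.2 - x.2 * y.1).

Fact lie_aff_linear_l y : linear (fun x => lie_aff x y).
Proof.
move=> a u v; congr pair; rewrite /= /GRing.scale /=; [by rewrite mulr0 addr0|].
by ring.
Qed.

Fact lie_aff_linear_r x : linear (lie_aff x).
Proof.
move=> a u v; congr pair; rewrite /= /GRing.scale /=; [by rewrite mulr0 addr0|].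
by ring.
Qed.

Fact lie_aff_alt x : lie_aff x x = 0.
Proof. by congr pair => /=; ring. Qed.

Fact lie_aff_jacobi x y z :
  lie_aff x (lie_aff y z) + lie_aff y (lie_aff z x) + lie_aff z (lie_aff x y)
    = 0.
Proof. by congr pair => /=; ring. Qed.

HB.instance Definition _ := isLieAlgebra.Build F A
  lie_aff_linear_l lie_aff_linear_r lie_aff_alt lie_aff_jacobi.

Definition aff_X : A := (1, 0).
Definition aff_Y : A := (0, 1).

Lemma lie_aff_XY : lie aff_X aff_Y = aff_Y.
Proof. by congr pair => /=; ring. Qed.

End Aff.

(* The triple (a, b, c) stands for sum_i (a_i X_i + b_i Y_i) + c Z. *)
Definition heisenbergLie (F : fieldType) (m : nat) : Type :=
  ('rV[F]_m * 'rV[F]_m * F^o)%type.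

Section Heisenberg.
Variables (F : fieldType) (m : nat).
Local Notation H := (heisenbergLie F m).

HB.instance Definition _ := Vector.on H.

Definition lie_heis (x y : H) : H :=
  (0, 0, \sum_(i < m) (x.1.1 0 i * y.1.2 0 i - x.1.2 0 i * y.1.1 0 i)).

Fact lie_heis_linear_l y : linear (fun x => lie_heis x y).
Proof.
move=> a u v; congr (_, _, _); rewrite /= ?scaler0 ?addr0 //.
rewrite /GRing.scale /= mulr_sumr -big_split; apply: eq_bigr => i _.
by rewrite !mxE /=; ring.
Qed.

Fact lie_heis_linear_r x : linear (lie_heis x).
Proof.
move=> a u v; congr (_, _, _); rewrite /= ?scaler0 ?addr0 //.
rewrite /GRing.scale /= mulr_sumr -big_split; apply: eq_bigr => i _.
by rewrite !mxE /=; ring.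
Qed.

Fact lie_heis_alt x : lie_heis x x = 0.
Proof. by congr (_, _, _); rewrite big1 // => i _; ring. Qed.

Fact lie_heis_jacobi x y z :
  lie_heis x (lie_heis y z) + lie_heis y (lie_heis z x)
    + lie_heis z (lie_heis x y) = 0.
Proof.
have lieZ u v w : lie_heis u (lie_heis v w) = 0.
  by congr (_, _, _); rewrite big1 // => i _; rewrite !mxE; ring.
by rewrite !lieZ !addr0.
Qed.

HB.instance Definition _ := isLieAlgebra.Build F H
  lie_heis_linear_l lie_heis_linear_r lie_heis_alt lie_heis_jacobi.

Definition heis_X (i : 'I_m) : H := (delta_mx 0 i, 0, 0).
Definition heis_Y (i : 'I_m) : H := (0, delta_mx 0 i, 0).
Definition heis_Z : H := (0, 0, 1).

Lemma lie_heis_XY i j : lie (heis_X i) (heis_Y j) = (i == j)%:R *: heis_Z.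
Proof.
congr (_, _, _); rewrite ?scaler0 //= (bigD1 i) //= big1 => [|k ki].
  by rewrite !mxE !eqxx /= /GRing.scale /=; ring.
by rewrite !mxE (negPf ki) /=; ring.
Qed.

Lemma lie_heis_XX i j : lie (heis_X i) (heis_X j) = 0.
Proof. by congr (_, _, _); rewrite big1 // => k _; rewrite !mxE; ring. Qed.

Lemma lie_heis_YY i j : lie (heis_Y i) (heis_Y j) = 0.
Proof. by congr (_, _, _); rewrite big1 // => k _; rewrite !mxE; ring. Qed.

Lemma lie_heis_Z x : lie heis_Z x = 0.
Proof. by congr (_, _, _); rewrite big1 // => k _; rewrite !mxE; ring. Qed.

End Heisenberg.

Inductive model_label : Type :=
| Aff
| AffAbelian
| Heisenberg of nat
| HeisenbergAbelian of nat.

Definition admissible (n : nat) (c : model_label) : Prop :=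
  match c with
  | Aff => n = 2%N
  | AffAbelian => (3 <= n)%N
  | Heisenberg m => (3 <= n)%N /\ n = (2 * m + 1)%N
  | HeisenbergAbelian m => (3 <= 2 * m + 1 < n)%N
  end.

Definition model (F : fieldType) (n : nat) (c : model_label) : lieAlgType F :=
  match c with
  | Aff => affLie F
  | AffAbelian => (affLie F * abelianLie F (n - 2))%type
  | Heisenberg m => heisenbergLie F m
  | HeisenbergAbelian m =>
      (heisenbergLie F m * abelianLie F (n - 2 * m - 1))%type
  end.

(* Main.v *)
(* If the derived ideal is the line spanned by z, then [x, y] = w(x, y) z for an
   alternating form w, and the Gram matrix of B_f is f(z) times that of w: its
   rank is 0 or rank w, which is the MD property.
   If z is not central, the Jacobi identity forces w to be decomposable and
   (w(-, z), w(x, -)) is a surjective morphism onto aff(R). If z is central, it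
   lies in the radical of w, and Darboux coordinates of w together with a
   functional taking the value 1 at z give a surjective morphism onto
   h_(2m+1). Coordinates on the kernel of that morphism, extended by 0 on z,
   supply the abelian factor.
   The models are told apart by whether [L, [L, L]] = 0, by the codimension 2m
   of the centre in the Heisenberg cases, and by n. *)
From HB Require Import structures.
Require Import Defs.
From mathcomp Require Import all_boot all_order all_algebra.
From mathcomp Require Import reals.
From mathcomp Require Import boolp ring.
Import GRing.Theory.
Local Open Scope ring_scope.

(** * Linear maps given as plain functions: rank-nullity and complementary coordinates *)

Section LinearMaps.
Context {F : fieldType}.
Implicit Types V W : vectType F.

Lemma linfunE {V W} (g : V -> W) : linear g -> exists G : 'Hom(V, W), G =1 g.
Proof.
move=> lg; pose g' := HB.pack_for {linear V -> W} g
  (GRing.isLinear.Build F V W *:%R _ lg).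
by exists (linfun g') => v; rewrite lfunE.
Qed.

Lemma dim_pair V W : \dim {: (V * W)%type} = (\dim {:V} + \dim {:W})%N.
Proof. by rewrite !dimvf. Qed.

Lemma dim_rV n : \dim {: 'rV[F]_n} = n.
Proof. by rewrite dimvf /dim /= mul1n. Qed.

Lemma limg_surj {V W} (G : 'Hom(V, W)) :
  (forall w, exists v, G v = w) -> limg G = fullv.
Proof.
move=> sG; apply/eqP; rewrite eqEsubv subvf /=; apply/subvP => w _.
by have [v <-] := sG w; rewrite memv_img ?memvf.
Qed.

Lemma dim_lker_surj {V W} (G : 'Hom(V, W)) :
  (forall w, exists v, G v = w) ->
  (\dim (lker G) + \dim {:W})%N = \dim {:V}.
Proof. by move=> /limg_surj <-; rewrite -(limg_ker_dim G fullv) capfv. Qed.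

Lemma linear_surj_bij {V W} (g : V -> W) :
  linear g -> (forall w, exists v, g v = w) -> \dim {:V} = \dim {:W} ->
  bijective g.
Proof.
move=> /linfunE[G GE] sg eqd.
have sG w : exists v, G v = w by have [v <-] := sg w; exists v; rewrite GE.
have kG : lker G == 0%VS.
  by rewrite -dimv_eq0 -(eqn_add2r (\dim {:W})) dim_lker_surj // eqd.
exists (G^-1)%VF => [v|w]; rewrite -GE ?lker0_lfunK //.
by rewrite limg_lfunVK // limg_surj ?memvf.
Qed.

(* The extra coordinates h are taken along <[z]>, so that they kill z. *)
Lemma linear_surj_extend {V W} k (g : V -> W) (z : V) :
  linear g -> (forall w, exists v, g v = w) -> g z != 0 ->
  \dim {:V} = (\dim {:W} + k)%N ->
  exists h : V -> 'rV[F]_k,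
    [/\ linear h, h z = 0 & bijective (fun v => (g v, h v))].
Proof.
move=> lg sg gz0 eqd; have [G GE] := linfunE _ lg.
have sG w : exists v, G v = w by have [v <-] := sg w; exists v; rewrite GE.
have dK : \dim (lker G) = k.
  by apply/eqP; rewrite -(eqn_add2r (\dim {:W})) dim_lker_surj // eqd addnC.
case: k / dK eqd => eqd.
have Kz0 : (lker G :&: <[z]> = 0)%VS.
  apply/eqP; rewrite -subv0; apply/subvP => t; rewrite memv_cap memv_ker.
  move=> /andP[+ /vlineP[c tE]]; rewrite {}tE linearZ /= scaler_eq0 GE.
  by rewrite (negPf gz0) orbF => /eqP ->; rewrite scale0r mem0v.
pose pr := daddv_pi (lker G) <[z]>%VS.
pose h v : 'rV_(\dim (lker G)) := \row_i coord (vbasis (lker G)) i (pr v).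
have lh : linear h by move=> a u v; apply/rowP => i; rewrite !mxE !linearP.
exists h; split=> //.
  have zz : z \in <[z]>%VS by exact: memv_line.
  (* [z] is the sum of its two projections and the one onto [<[z]>] is [z] itself, so [pr z]
     vanishes. *)
  have := daddv_pi_add Kz0 (subvP (addvSr (lker G) _) _ zz).
  rewrite [X in _ + X]daddv_pi_id 1?capvC // -[RHS]add0r => /addIr prz.
  by apply/rowP => i; rewrite !mxE [pr z]prz linear0.
apply: linear_surj_bij.
- by move=> a u v; congr pair; [apply: lg | apply: lh].
- move=> [w r]; have [v0 gv0] := sg w.
  (* Adding a kernel vector changes [h] without changing [g]; [t] supplies the gap between the
     wanted [r] and [h v0]. *)
  pose t := \sum_i (r - h v0) 0 i *: (vbasis (lker G))`_i.
  have tK : t \in lker G.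
    apply: memv_suml => i _.
    by rewrite memvZ // vbasis_mem // mem_nth ?size_tuple.
  exists (t + v0); congr pair.
    move: tK; rewrite memv_ker => /eqP t0.
    by rewrite -GE linearD /= t0 add0r GE.
  apply/rowP => i; rewrite mxE linearD linearD /= [pr t]daddv_pi_id //.
  rewrite coord_sum_free ?(basis_free (vbasisP _)) //.
  by rewrite !mxE subrK.
- by rewrite eqd dim_pair dim_rV.
Qed.

End LinearMaps.

(** * Darboux normal form of an alternating bilinear form *)

Section Darboux.
Context {F : fieldType} {V : vectType F}.

(** Written exactly as the last component of [lie_heis], so that Darboux coordinates give the
    Heisenberg bracket by conversion. *)
Definition symplectic_sum {m} (p q : 'rV[F]_m * 'rV[F]_m) : F :=
  \sum_(i < m) (p.1 0 i * q.2 0 i - p.2 0 i * q.1 0 i).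

(** Basis vectors of either half read off the coordinates of the other. Hence a surjective Darboux
    map kills the radical of its form. *)
Lemma symplectic_sum_nondeg {m} (p : 'rV[F]_m * 'rV[F]_m) :
  (forall q, symplectic_sum p q = 0) -> p = 0.
Proof.
case: p => a b p0; congr pair; apply/rowP => i; rewrite mxE.
- have := p0 (0, delta_mx 0 i); rewrite /symplectic_sum (bigD1 i) //= big1.
    by rewrite !mxE !eqxx => /= <-; ring.
  by move=> j ji; rewrite !mxE (negPf ji) /=; ring.
- have := p0 (- delta_mx 0 i, 0); rewrite /symplectic_sum (bigD1 i) //= big1.
    by rewrite !mxE !eqxx => /= <-; ring.
  by move=> j ji; rewrite !mxE (negPf ji) /=; ring.
Qed.

Definition bilinear_form (w : V -> V -> F) :=
  (forall y, scalar (w^~ y)) /\ (forall x, scalar (w x)).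

Section Bilinear.
Context {w : V -> V -> F} (w_bil : bilinear_form w).

Lemma form_Dl u v x : w (u + v) x = w u x + w v x.
Proof. by have := w_bil.1 x 1 u v; rewrite scale1r mul1r. Qed.

Lemma form_Dr u v x : w x (u + v) = w x u + w x v.
Proof. by have := w_bil.2 x 1 u v; rewrite scale1r mul1r. Qed.

Lemma form_0l x : w 0 x = 0.
Proof. by apply: (addrI (w 0 x)); rewrite -form_Dl !addr0. Qed.

Lemma form_Zl a u x : w (a *: u) x = a * w u x.
Proof. by have := w_bil.1 x a u 0; rewrite form_0l !addr0. Qed.

Lemma form_altC : (forall x, w x x = 0) -> forall x y, w x y = - w y x.
Proof.
move=> alt x y; apply/eqP; rewrite -addr_eq0 -(alt (x + y)).
by rewrite form_Dl !form_Dr !alt add0r addr0.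
Qed.

End Bilinear.

(* Given w x y = 1, subtracting the hyperbolic form w(-,y) /\ w(x,-) puts x
   into the radical, so the codimension k of a subspace U of the radical
   decreases. *)
Lemma darboux k (w : V -> V -> F) (U : {vspace V}) :
  bilinear_form w -> (forall x, w x x = 0) ->
  (\dim {:V} <= k + \dim U)%N -> (forall u v, u \in U -> w u v = 0) ->
  exists m (p : V -> 'rV[F]_m * 'rV[F]_m),
    [/\ linear p, forall q, exists v, p v = q
      & forall u v, w u v = symplectic_sum (p u) (p v)].
Proof.
elim: k w U => [|k IH] w U w_bil alt dU radU.
all: have [[x [y wxy]]|w0] := pselect (exists x y, w x y != 0); last first.
(* A zero form needs no hyperbolic pair, in the base case and in the inductive case alike. *)
1,3: exists 0%N, (fun=> (0, 0)); split=> [a u v|[q r]|u v];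
  [by rewrite scaler0 addr0 | by exists 0; congr pair; apply/rowP => -[] |];
  by rewrite /symplectic_sum big_ord0; apply: contrapT => /eqP ?; apply: w0;
     exists u, v.
  (* For codimension bound 0 the radical is the whole space, against [w x y != 0]. *)
  have UT : U = fullv by apply/eqP; rewrite eqEdim subvf.
  by rewrite radU ?eqxx ?UT ?memvf in wxy.
have wC := form_altC w_bil alt.
wlog wxy1 : x {wxy} / w x y = 1.
  by move=> /(_ ((w x y)^-1 *: x)); apply; rewrite (form_Zl w_bil) mulVf.
pose w' u v := w u v - (w u y * w x v - w x u * w v y).
have w'x v : w' x v = 0 by rewrite /w' wxy1 alt; ring.
have w'C u v : w' u v = - w' v u by rewrite /w' (wC u v); ring.
have w'y v : w' y v = 0 by rewrite /w' wxy1 alt (wC y v); ring.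
have [w_l w_r] := w_bil.
have [||||m [p [lp sp pE]]] := IH w' (<[x]> + U)%VS.
- by split=> v a u1 u2; rewrite /w' w_l !w_r ?w_l; ring.
- by move=> v; rewrite /w' alt; ring.
(* Since [w x y = 1], [x] is outside [U], so adjoining it raises the dimension by one. *)
- have xU : x \notin U.
    by apply/negP => /(radU x y)/eqP; rewrite wxy1 oner_eq0.
  have x0 : x != 0 by apply: contraNneq xU => ->; rewrite mem0v.
  rewrite dimv_disjoint_sum ?dim_vline ?x0 ?addnA ?addn1 //.
  apply/eqP; rewrite -subv0; apply/subvP => t; rewrite memv_cap.
  move=> /andP[/vlineP[c ->] cxU]; rewrite memv0 scaler_eq0 (negPf x0) orbF.
  by apply: contraNT xU => c0; rewrite -(scalerK c0 x) memvZ.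
- move=> _ v /memv_addP[_ /vlineP[c ->] [u uU ->]].
  rewrite w'C; apply/eqP; rewrite oppr_eq0 /w' !w_r w_l.
  rewrite (wC v x) (wC v u) (wC x u) !(radU u _ uU) alt wxy1.
  by apply/eqP; ring.
(* Both [x] and [y] are in the radical of [w'], so [p] kills them and they can adjust the new
   coordinates independently of [p]. *)
have px : p x = 0.
  by apply: symplectic_sum_nondeg => q; have [v <-] := sp q; rewrite -pE.
have py : p y = 0.
  by apply: symplectic_sum_nondeg => q; have [v <-] := sp q; rewrite -pE.
exists (1 + m)%N,
  (fun v => (row_mx (w v y)%:M (p v).1, row_mx (w x v)%:M (p v).2)).
split.
- move=> a u v; rewrite lp w_l w_r; congr pair;
    by rewrite /= scale_row_mx add_row_mx scale_scalar_mx -raddfD.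
- move=> [q r]; have [v pv] := sp (rsubmx q, rsubmx r).
  (* In the two new coordinates [x] is (1, 0) and [y] is (0, 1); the coefficients correct those of
     [v]. *)
  exists ((lsubmx q 0 0 - w v y) *: x + ((lsubmx r 0 0 - w x v) *: y + v)).
  rewrite !lp px py !scaler0 !add0r !w_l !w_r pv wxy1 !alt.
  by congr pair; rewrite -[RHS]hsubmxK; congr row_mx; apply/matrixP=> i j;
     rewrite !ord1 !mxE /=; ring.
- move=> u v; have := pE u v; rewrite /w' => /eqP; rewrite subr_eq => /eqP ->.
  rewrite addrC /symplectic_sum big_split_ord big_ord1 /=.
  rewrite !row_mxEl !mxE eqxx; congr (_ + _).
  by apply: eq_bigr => i _; rewrite !row_mxEr.
Qed.
End Darboux.

(** * Lie isomorphisms obtained from surjective morphisms *)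

Section LieIso.
Context {F : fieldType}.
Implicit Types L M : lieAlgType F.

Lemma lie0r {L} (x : L) : lie x 0 = 0.
Proof.
by apply: (addrI (lie x 0)); have := lie_linear_r x 1 0 0;
   rewrite !scale1r !addr0.
Qed.

Lemma lieZr {L} a (x y : L) : lie x (a *: y) = a *: lie x y.
Proof. by have := lie_linear_r x a y 0; rewrite lie0r !addr0. Qed.

Lemma lie_isoI {L M} (f : L -> M) :
  linear f -> bijective f -> (forall x y, f (lie x y) = lie (f x) (f y)) ->
  lie_iso L M.
Proof.
move=> lf bf hf; pose f' := HB.pack_for {linear L -> M} f
  (GRing.isLinear.Build F L M *:%R _ lf).
by exists f'.
Qed.

Lemma lie_iso_surj {L M} (p : L -> M) :
  linear p -> (forall q, exists v, p v = q) ->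
  (forall x y, p (lie x y) = lie (p x) (p y)) ->
  \dim {:L} = \dim {:M} -> lie_iso L M.
Proof.
by move=> lp sp hp eqd; apply: (lie_isoI p) => //; exact: linear_surj_bij.
Qed.

(** The extra coordinates [h] kill [z], hence every bracket, so [h] is a morphism to the abelian
    algebra; [p z != 0] permits such a choice of [h]. *)
Lemma lie_iso_surj_abelian {L M} k (p : L -> M) (z : L) :
  linear p -> (forall q, exists v, p v = q) ->
  (forall x y, p (lie x y) = lie (p x) (p y)) ->
  (forall x y, lie x y \in <[z]>%VS) -> p z != 0 ->
  \dim {:L} = (\dim {:M} + k)%N -> lie_iso L (M * abelianLie F k)%type.
Proof.
move=> lp sp hp Lz pz0 eqd.
have [h [lh hz bh]] := linear_surj_extend k p z lp sp pz0 eqd.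
apply: (lie_isoI (fun v => (p v, h v) : M * abelianLie F k)) => //.
  by move=> a u v; congr pair; [apply: lp | apply: lh].
move=> x y; congr pair; first exact: hp.
have /vlineP[a ->] := Lz x y.
have h0 : h 0 = 0.
  by apply: (addrI (h 0)); have := lh 1 0 0; rewrite !scale1r !addr0.
by have := lh a z 0; rewrite hz h0 !addr0 scaler0.
Qed.

End LieIso.

(** * Lie algebras whose derived ideal is a line *)

Section OneDimensionalDerivedIdeal.
Context {F : fieldType} {L : lieAlgType F}.
Hypothesis dimL1 : \dim (derived_ideal L) = 1%N.

(** [c] extends the coordinate on the derived line to all of [L], so the scalar form [c (lie x y)]
    carries the whole bracket. *)
Lemma derived_line : exists (z : L) (c : {scalar L}),
  [/\ c z = 1, forall x y, lie x y = c (lie x y) *: z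
    & exists x y, c (lie x y) != 0].
Proof.
pose z := vpick (derived_ideal L).
have z0 : z != 0 by rewrite vpick0 -dimv_eq0 dimL1.
have Dz : derived_ideal L = <[z]>%VS.
  by apply/esym/eqP; rewrite eqEdim -memvE memv_pick dim_vline z0 dimL1.
pose c : {scalar L} := coord [tuple z] ord0.
have cz : c z = 1.
  by rewrite -[z]/([tuple z]`_(@ord0 0)) [c _]coord_free ?eqxx // seq1_free.
have lieE x y : lie x y = c (lie x y) *: z.
  have /vlineP[k ->] : lie x y \in <[z]>%VS by rewrite -Dz mem_lie_prod ?memvf.
  by rewrite linearZ /= cz mulr1.
exists z, c; split=> //; apply: contrapT => c0.
suff : (derived_ideal L <= 0)%VS by rewrite subv0 Dz -dimv_eq0 dim_vline z0.
apply: lie_prod_subP => x y _ _; rewrite lieE memv0 scaler_eq0; apply/orP; left.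
by apply: contrapT => /negP ?; apply: c0; exists x, y.
Qed.

Lemma lie_form_bilinear (c : {scalar L}) :
  bilinear_form (fun x y => c (lie x y)).
Proof.
by split=> v a x y; rewrite /= ?lie_linear_l ?lie_linear_r linearP.
Qed.

Lemma dim1_MD : lie_solvable L -> MD_algebra L.
Proof.
move=> solL; split=> // f; have [z [c [_ lieE _]]] := derived_line.
pose w : 'M_(\dim {:L}) :=
  \matrix_(i, j) c (lie (vbasis {:L})`_i (vbasis {:L})`_j).
have KE g : Korbit_dim g = \rank ((g z : F) *: w).
  congr (\rank _); apply/matrixP => i j.
  by rewrite !mxE /coadj_form {1}lieE linearZ /= mulrC.
have [fz|fz] := eqVneq (f z) 0; [left|right=> f'].
  by rewrite KE fz scale0r mxrank0.
by rewrite !KE (mxrank_scale_nz w fz) mxrank_scale.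
Qed.

(* If z is not central, the Jacobi identity shows that the form w with
   [u, v] = w(u, v) z is w(-, z) /\ w(x, -), for any x with [x, z] = z. *)
Lemma noncentral_affLie (z x0 : L) (c : {scalar L}) :
  c z = 1 -> (forall x y, lie x y = c (lie x y) *: z) -> lie x0 z != 0 ->
  exists p : L -> affLie F,
    [/\ linear p, forall q, exists v, p v = q,
        forall x y, p (lie x y) = lie (p x) (p y) & p z != 0].
Proof.
move=> cz lieE x0z; pose w x y := c (lie x y).
have w_bil : bilinear_form w := lie_form_bilinear c.
have alt x : w x x = 0 by rewrite /w lie_alt linear0.
have wC := form_altC w_bil alt; have [w_l w_r] := w_bil.
have [x wxz] : exists x, w x z = 1.
  exists ((w x0 z)^-1 *: x0); rewrite (form_Zl w_bil) mulVf //.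
  by apply: contraNneq x0z => w0; rewrite lieE [c _]w0 scale0r.
have jac u v : w u v = w u z * w x v - w v z * w x u.
  have := congr1 c (lie_jacobi x u v).
  rewrite (lieE u v) (lieE v x) (lieE x u) !lieZr !linearD !linearZ linear0 /=.
  rewrite -!/(w _ _) wxz (wC v x) => /eqP.
  by rewrite mulr1 -addrA addr_eq0 => /eqP ->; ring.
pose p v : affLie F := (w v z, w x v).
have lp : linear p by move=> a u v; congr pair; [apply: w_l | apply: w_r].
have pz : p z = (0, 1) by rewrite /p alt wxz.
exists p; split=> //.
(* [p] sends [x] to (1, 0) and [z] to (0, 1), the basis [aff_X], [aff_Y]. *)
- move=> [a b]; exists ((a : F) *: x + (b : F) *: z).
  rewrite /p w_l (form_Zl w_bil) w_r alt wxz (wC x (_ *: z)) (form_Zl w_bil).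
  rewrite (wC z x) alt wxz.
  by congr pair; ring.
- move=> u v; rewrite lieE; have := lp (w u v) z 0.
  rewrite {3}/p (form_0l w_bil) (wC x 0) (form_0l w_bil) !addr0 => ->.
  rewrite pz; congr pair; rewrite /= /GRing.scale /= ?oppr0; first by ring.
  by rewrite (jac u v); ring.
- by rewrite pz; apply/eqP => -[/eqP]; rewrite oner_eq0.
Qed.

(** A central [z] is in the radical of [w], so the Darboux map [q] kills all brackets; pairing it
    with [c] restores the coordinate along [z]. *)
Lemma central_heisenbergLie (z : L) (c : {scalar L}) :
  c z = 1 -> (forall x y, lie x y = c (lie x y) *: z) ->
  (exists x y, c (lie x y) != 0) -> (forall x, lie x z = 0) ->
  exists m (p : L -> heisenbergLie F m),
    [/\ (0 < m)%N, linear p, forall q, exists v, p v = q,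
        forall x y, p (lie x y) = lie (p x) (p y) & p z != 0].
Proof.
move=> cz lieE [x [y cxy]] zZ; pose w x y := c (lie x y).
have w_bil : bilinear_form w := lie_form_bilinear c.
have alt v : w v v = 0 by rewrite /w lie_alt linear0.
(* The zero subspace, with the full dimension as codimension bound, is a valid start for any
   form. *)
have [|u v|m [q [lq sq wE]]] := darboux (\dim {:L}) w 0%VS w_bil alt.
- by rewrite leq_addr.
- by rewrite memv0 => /eqP ->; rewrite (form_0l w_bil).
have qz : q z = 0.
  apply: symplectic_sum_nondeg => r; have [v <-] := sq r.
  by rewrite -wE (form_altC w_bil alt) /w zZ linear0 oppr0.
pose p v : heisenbergLie F m := (q v, c v).
have lp : linear p by move=> a u v; congr pair; [apply: lq | apply: linearP].
have q0 : q 0 = 0.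
  by have := lq (-1) z z; rewrite qz scaler0 addr0 scaleN1r addNr.
exists m, p; split=> //.
- case: m q lq sq wE {p lp qz q0} => // q _ _ wE.
  by move: cxy; rewrite -/(w x y) wE /symplectic_sum big_ord0 eqxx.
(* As [q z = 0] and [c z = 1], adding a multiple of [z] adjusts the last coordinate only. *)
- move=> [r t]; have [v qv] := sq r; exists ((t - c v : F) *: z + v).
  rewrite /p lq qz scaler0 add0r qv; congr pair.
  by rewrite linearP /= cz mulr1 subrK.
- move=> u v; rewrite /p; congr pair; last exact: wE.
  rewrite lieE; have := lq (c (lie u v)) z 0.
  by rewrite qz q0 scaler0 !addr0.
- by apply/eqP => -[_ /eqP]; rewrite cz oner_eq0.
Qed.

(** Centrality of [z] selects the family; the kernel of the surjection [p] then measures the abelian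
    factor, absent when the kernel is zero. *)
Lemma dim1_classification :
  exists2 l, admissible (\dim {:L}) l & lie_iso L (model F (\dim {:L}) l).
Proof.
have [z [c [cz lieE c0]]] := derived_line.
have Lz x y : lie x y \in <[z]>%VS by rewrite lieE memvZ ?memv_line.
have [[x0 x0z]|zZ] := pselect (exists x, lie x z != 0).
- have [p [lp sp hp pz]] := noncentral_affLie z x0 c cz lieE x0z.
  have d2 : \dim {:affLie F} = 2%N by rewrite dimvf.
  have [P PE] := linfunE p lp.
  have sP q : exists v, P v = q by have [v <-] := sp q; exists v.
  have := dim_lker_surj P sP; rewrite d2 => dL.
  have [k0|k_gt0] := posnP (\dim (lker P)).
    exists Aff; first by rewrite /= -dL k0.
    by apply: (lie_iso_surj p) => //; rewrite d2 -dL k0.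
  exists AffAbelian; first by rewrite /= -dL addn2.
  apply: (lie_iso_surj_abelian _ p z) => //.
  by rewrite d2 -dL subn2 /= addn2 add2n.
- have {}zZ x : lie x z = 0.
    by apply: contrapT => /eqP ?; apply: zZ; exists x.
  have [m [p [m_gt0 lp sp hp pz]]] := central_heisenbergLie z c cz lieE c0 zZ.
  have dm : \dim {:heisenbergLie F m} = (2 * m + 1)%N.
    by rewrite !dim_pair !dim_rV mul2n addnn dimvf.
  have [P PE] := linfunE p lp.
  have sP q : exists v, P v = q by have [v <-] := sp q; exists v.
  have := dim_lker_surj P sP; rewrite dm => dL.
  have m3 : (3 <= 2 * m + 1)%N by rewrite addn1 ltnS -[2%N]muln1 leq_mul2l.
  have [k0|k_gt0] := posnP (\dim (lker P)).
    exists (Heisenberg m); first by rewrite /= -dL k0.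
    by apply: (lie_iso_surj p) => //; rewrite dm -dL k0.
  exists (HeisenbergAbelian m).
    by rewrite /= -dL m3 -[ltnLHS]add0n ltn_add2r.
  apply: (lie_iso_surj_abelian _ p z) => //.
  by rewrite dm -dL -subnDA addnK addnC.
Qed.

End OneDimensionalDerivedIdeal.

(** * Isomorphism invariants of the models *)

Section Invariants.
Context {F : fieldType}.
Implicit Types L M : lieAlgType F.

Definition two_step L := forall x y t : L, lie t (lie x y) = 0.

Lemma lie_iso_two_step L M : lie_iso L M -> two_step L <-> two_step M.
Proof.
move=> [f [g fK gK] hf]; split=> ts x y t.
- by rewrite -(gK x) -(gK y) -(gK t) -!hf ts linear0.
- by apply: (can_inj fK); rewrite !hf ts linear0.
Qed.

(* p is the quotient by the centre, which has codimension 2m. *)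
Definition heis_type L m := exists p : L -> 'rV[F]_m * 'rV[F]_m,
  [/\ linear p, forall q, exists v, p v = q
    & forall x, p x = 0 <-> forall y, lie x y = 0].

Lemma lie_iso_heis_type L M m : lie_iso L M -> heis_type M m -> heis_type L m.
Proof.
move=> [f [g fK gK] hf] [p [lp sp pE]]; exists (p \o f); split=> [a u v|q|x] /=.
- by rewrite linearP lp.
- by have [v <-] := sp q; exists (g v); rewrite gK.
- split=> [/pE fx0 y|x0]; first by apply: (can_inj fK); rewrite hf fx0 linear0.
  by apply/pE => y; rewrite -(gK y) -hf x0 linear0.
Qed.

(** Both maps have the centre as kernel, so rank-nullity gives 2m = 2m'. *)
Lemma heis_type_inj L m m' : heis_type L m -> heis_type L m' -> m = m'.
Proof.
move=> [p [/linfunE[P PE] sp pZ]] [p' [/linfunE[P' PE'] sp' pZ']].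
have eqK : lker P = lker P'.
  apply/vspaceP => v; rewrite !memv_ker PE PE'.
  by apply/eqP/eqP => [/pZ/pZ'|/pZ'/pZ].
have sP q : exists v, P v = q by have [v <-] := sp q; exists v.
have sP' q : exists v, P' v = q by have [v <-] := sp' q; exists v.
have /eqP := dim_lker_surj P sP; rewrite -(dim_lker_surj P' sP') eqK.
rewrite eqn_add2l !dim_pair !dim_rV !addnn => /eqP; exact: double_inj.
Qed.

(** By nondegeneracy of [symplectic_sum], the centre is the last coordinate axis, which is the
    kernel of [fst]. *)
Lemma heisenbergLie_heis_type m : heis_type (heisenbergLie F m) m.
Proof.
exists fst; split=> // [q|x]; first by exists (q, 0).
split=> [x0 y|x0].
  congr pair; rewrite /= x0 big1 // => i _; rewrite !mxE; ring.
by apply: symplectic_sum_nondeg => q; have := congr1 snd (x0 (q, 0)).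
Qed.

Lemma heisenbergLie_abelian_heis_type m k :
  heis_type (heisenbergLie F m * abelianLie F k)%type m.
Proof.
have [p [lp sp pZ]] := heisenbergLie_heis_type m.
exists (p \o fst); split=> [a u v|q|x] /=; first exact: lp.
  by have [v <-] := sp q; exists (v, 0).
split=> [/pZ x0 y|x0]; first by congr pair; apply: x0.
by apply/pZ => y; have := congr1 fst (x0 (y, 0)).
Qed.

(** The witness is [X, [X, Y]] = Y. *)
Lemma affLie_not_two_step : ~ two_step (affLie F).
Proof.
move=> /(_ (aff_X F) (aff_Y F) (aff_X F)); rewrite !lie_aff_XY.
by move=> [/eqP]; rewrite oner_eq0.
Qed.

Lemma affLie_abelian_not_two_step k :
  ~ two_step (affLie F * abelianLie F k)%type.
Proof.
move=> ts; apply: affLie_not_two_step => x y t.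
by have := congr1 fst (ts (x, 0) (y, 0) (t, 0)).
Qed.

Lemma heisenbergLie_two_step m : two_step (heisenbergLie F m).
Proof.
move=> x y t; congr pair; rewrite /= big1 // => i _.
by rewrite !mxE; ring.
Qed.

Lemma heisenbergLie_abelian_two_step m k :
  two_step (heisenbergLie F m * abelianLie F k)%type.
Proof. by move=> x y t; congr pair; apply: heisenbergLie_two_step. Qed.

Lemma model_label_unique L n l l' :
  admissible n l -> lie_iso L (model F n l) ->
  admissible n l' -> lie_iso L (model F n l') -> l = l'.
Proof.
have two_stepE M M' : lie_iso L M -> lie_iso L M' -> two_step M -> two_step M'.
  by move=> /lie_iso_two_step h /lie_iso_two_step h' /h/h'.
have heisE m m' M M' : lie_iso L M -> lie_iso L M' ->
    heis_type M m -> heis_type M' m' -> m = m'.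
  move=> i i' /(lie_iso_heis_type _ _ _ i) + /(lie_iso_heis_type _ _ _ i').
  exact: heis_type_inj.
have [affN affAN] := (affLie_not_two_step, affLie_abelian_not_two_step).
have [heisS heisAS] := (heisenbergLie_two_step, heisenbergLie_abelian_two_step).
have [heisT heisAT] :=
  (heisenbergLie_heis_type, heisenbergLie_abelian_heis_type).
case: l l' => [||m|m] [||m'|m'] //= al il al' il';
  try by [case: affN; apply: (two_stepE _ _ il il')
         |case: affN; apply: (two_stepE _ _ il' il)
         |case: (affAN (n - 2)%N); apply: (two_stepE _ _ il il')
         |case: (affAN (n - 2)%N); apply: (two_stepE _ _ il' il)].
(* The remaining pairs of labels are in one family: the codimension of the centre fixes [m], and [n]
   detects the abelian factor. *)
- by move: al'; rewrite al.
- by move: al; rewrite al'.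
- by rewrite (heisE _ _ _ _ il il' (heisT m) (heisT m')).
- move: al al'; rewrite (heisE _ _ _ _ il il' (heisT m) (heisAT m' _)).
  by move=> [_ ->]; rewrite ltnn andbF.
- move: al al'; rewrite (heisE _ _ _ _ il il' (heisAT m _) (heisT m')).
  by move=> + [_ nE]; rewrite nE ltnn andbF.
- by rewrite (heisE _ _ _ _ il il' (heisAT m _) (heisAT m' _)).
Qed.

End Invariants.

Theorem theorem4p1 (R : realType) :
  (forall L : lieAlgType R,
     MD_star1 L <-> lie_solvable L /\ \dim (derived_ideal L) = 1%N) /\
  (forall (n : nat) (L : lieAlgType R),
     (2 <= n)%N -> \dim {:L} = n -> lie_solvable L ->
     \dim (derived_ideal L) = 1%N ->
     MD_nm L n 1 /\
     exists! c : model_label, admissible n c /\ lie_iso L (model R n c)).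
Proof.
split=> [L|n L n2 dL solL dL1].
  split=> [[[solL _] dL1]|[solL dL1]]; split=> //.
  exact: dim1_MD.
split; first by split=> //; apply: dim1_MD.
have [l al il] := dim1_classification dL1; rewrite dL in al il.
exists l; split=> // l' [al' il'].
exact: model_label_unique al il al' il'.
Qed.
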